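(* Let $U\in U(2)$, let $\epsilon>0$, and let $n_b$ be a positive integer such that $\|U^{1/2^{n_b-1}}-I\|_{\max}\le\epsilon$. Let $n_c$ be a positive integer and $n=n_c+1$ with $n\ge n_b+8$. Then an approximate decomposition of the $n_c$-controlled gate $C^{n_c}U$, up to error $\epsilon$, can be constructed on the $n$ qubits (no auxiliary qubits) using at most $$4(n_b-1)^2+32n-112$$ CNOT gates (together with single-qubit gates).
   Context: $C^{n_c}U$ denotes the $(n_c+1)$-qubit gate with control qubits $c_1,\dots,c_{n_c}$ and target qubit $t$ that applies $U$ to $t$ when all controls are in state $|1\rangle$ and the identity otherwise. An approximate decomposition up to error $\epsilon$ is a circuit of CNOT and single-qubit gates on these $n_c+1$ qubits such that, for each computational basis state $x$ of the controls, the operator $V_x$ applied to the target satisfies $\|V_x-U\|_{\max}\le\epsilon$ if $x=1\cdots1$ and $\|V_x-I\|_{\max}\le\epsilon$ otherwise. Here $\|M\|_{\max}=\max_{i,j}|M_{ij}|$, and for $U=W\,\mathrm{diag}(e^{i\theta_1},e^{i\theta_2})W^\dagger$ with $W$ unitary and $\theta_j\in(-\pi,\pi]$, $U^{1/N}=W\,\mathrm{diag}(e^{i\theta_1/N},e^{i\theta_2/N})W^\dagger$. *)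

(* Defs.v *)
From HB Require Import structures.
From mathcomp Require Import all_boot all_order all_algebra.
From mathcomp Require Import complex.
From mathcomp Require Import reals trigo.

Set Implicit Arguments.
Unset Strict Implicit.
Unset Printing Implicit Defensive.

Import Order.TTheory GRing.Theory Num.Theory.
Local Open Scope ring_scope.
Local Open Scope complex_scope.

Section Defs.
Variable R : realType.
Local Notation C := R[i].

Definition adjmx m n (M : 'M[C]_(m, n)) : 'M[C]_(n, m) := (map_mx conjc M)^T.

Definition qunitary n (M : 'M[C]_n) : Prop := M *m adjmx M = 1%:M.

Definition expi (t : R) : C := Complex (cos t) (sin t).

Definition maxnorm_le m n (M : 'M[C]_(m, n)) (eps : R) : Prop :=
  forall i j, `|M i j| <= eps%:C.

Definition diag2 (a b : C) : 'M[C]_2 :=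
  \matrix_(i < 2, j < 2) (if i == j then (if i == 0 then a else b) else 0).

Definition principal_root (U : 'M[C]_2) (N : nat) (V : 'M[C]_2) : Prop :=
  exists (W : 'M[C]_2) (t1 t2 : R),
    [/\ qunitary W,
        - pi < t1 <= pi, - pi < t2 <= pi,
        U = W *m diag2 (expi t1) (expi t2) *m adjmx W &
        V = W *m diag2 (expi (t1 / N%:R)) (expi (t2 / N%:R)) *m adjmx W].

Inductive gate (n : nat) : Type :=
| CNOT of 'I_n & 'I_n                (* control, target *)
| Single of 'I_n & 'M[C]_2.

Definition gate_valid n (g : gate n) : Prop :=
  match g with
  | CNOT c t => c <> t
  | Single _ G => qunitary G
  end.

Definition is_cnot n (g : gate n) : bool :=
  if g is CNOT _ _ then true else false.

Definition bits n := {ffun 'I_n -> bool}.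
Definition state n := bits n -> C.

Definition setbit n (x : bits n) (q : 'I_n) (b : bool) : bits n :=
  [ffun i => if i == q then b else x i].

Definition bidx (b : bool) : 'I_2 := if b then ord_max else ord0.

Definition gate_apply n (g : gate n) (psi : state n) : state n :=
  match g with
  | CNOT c t => fun x => psi (if x c then setbit x t (~~ x t) else x)
  | Single q G => fun x =>
      G (bidx (x q)) (bidx false) * psi (setbit x q false)
      + G (bidx (x q)) (bidx true) * psi (setbit x q true)
  end.

Definition circ_apply n (c : seq (gate n)) (psi : state n) : state n :=
  foldl (fun s g => gate_apply g s) psi c.

Definition kbasis n (x : bits n) : state n := fun y => if y == x then 1 else 0.

Definition ctrl nc (x : bits nc.+1) : bits nc :=
  [ffun i : 'I_nc => x (widen_ord (leqnSn nc) i)].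
Definition tgt nc (x : bits nc.+1) : bool := x ord_max.

(** The circuit acts as sum_x |x><x| (x) V_x on controls (x) target,
    with V_x - U and V_x - I bounded in max-norm by eps. *)
Definition approx_CU nc (c : seq (gate nc.+1)) (U : 'M[C]_2) (eps : R) : Prop :=
  exists V : bits nc -> 'M[C]_2,
    (forall x y : bits nc.+1,
        circ_apply c (kbasis x) y =
        (if ctrl y == ctrl x then V (ctrl x) (bidx (tgt y)) (bidx (tgt x)) else 0))
    /\ (forall xc : bits nc,
          if xc == [ffun => true] then maxnorm_le (V xc - U) eps
          else maxnorm_le (V xc - 1%:M) eps).

Definition all_valid n (c : seq (gate n.+1)) : Prop :=
  forall i : 'I_(size c), gate_valid (nth (CNOT ord0 ord0) c i).

End Defs.

(* Main.v *)
Require Import Defs.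
From HB Require Import structures.
From mathcomp Require Import all_boot all_order all_algebra.
From mathcomp Require Import complex ring lra zify.
From mathcomp Require Import boolp reals trigo.
Import Order.TTheory GRing.Theory Num.Theory.
Local Open Scope ring_scope.
Local Open Scope complex_scope.
Set Implicit Arguments.
Unset Strict Implicit.
Unset Printing Implicit Defensive.

(** Split the controls into a register of m = n_b - 1 qubits, read as an integer v, and
    the k >= 8 others, whose conjunction is a. Since
      [all controls are 1] = (v + a - ((v + a) mod 2^m)) / 2^m
    the gate can be obtained from the phases U^(v/2^m), which need only one-control gates,
    and their conjugate by the map v -> v + a. The term U^(a/2^m) is replaced by the
    unconditional U^(1/2^m): this is exact on the all-ones branch, and elsewhere gives
    either the identity or U^(1/2^m).

    Up to a phase that cancels in the conjugation, v -> v + a is a Fourier circuit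
    conjugating single-qubit Z-rotations controlled by a. Halving the k controls, a = a1 a2,
    these rotations are a commutator R T1 R^-1 T2 R T1 R^-1 T2 in which Ti flips the register
    when ai holds. Fanning out with CNOTs reduces Ti to one multi-controlled NOT, which
    costs 8p - 6 CNOTs for p controls because the other half of the controls supplies
    p - 1 borrowed qubits. *)

(** * Unit complex phases and explicit two-by-two matrices *)

Section Phases.
Variable R : realType.
Local Notation C := R[i].
Implicit Types a : R.

Lemma expiD a (a' : R) : expi (a + a') = expi a * expi a' :> C.
Proof.
by rewrite /expi cosD sinD /=; congr Complex; rewrite addrC [X in _ + X]mulrC.
Qed.

Lemma expi0 : expi 0 = 1 :> C.
Proof. by rewrite /expi cos0 sin0. Qed.

Lemma expi_pi : expi pi = -1 :> C.
Proof. by rewrite /expi cospi sinpi; apply/eqP; rewrite eq_complex /= oppr0 !eqxx. Qed.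

Lemma conj_expi a : conjc (expi a) = expi (- a) :> C.
Proof. by rewrite /expi cosN sinN. Qed.

Lemma expiNpi : expi (- pi) = -1 :> C.
Proof. by rewrite -conj_expi expi_pi rmorphN rmorph1. Qed.

Lemma bidx_sum (V : nmodType) (F : 'I_2 -> V) :
  \sum_(j < 2) F j = F (bidx false) + F (bidx true).
Proof.
rewrite !big_ord_recl big_ord0 addr0.
by congr (_ + _); congr F; apply: val_inj.
Qed.

Lemma bidx_mxP (A B : 'M[C]_2) :
  (forall i j, A (bidx i) (bidx j) = B (bidx i) (bidx j)) -> A = B.
Proof.
have idxP (i : 'I_2) : exists b : bool, i = bidx b.
  by case: i => -[|[|//]] lti; [exists false | exists true]; apply: val_inj.
by move=> AB; apply/matrixP => i j; have [[b ->] [d ->]] := (idxP i, idxP j).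
Qed.

Lemma mul2E (A B : 'M[C]_2) i j :
  (A *m B) i j = A i (bidx false) * B (bidx false) j
                 + A i (bidx true) * B (bidx true) j.
Proof. by rewrite mxE bidx_sum. Qed.

Lemma diag2E (a b : C) i j :
  diag2 a b (bidx i) (bidx j) = if i == j then (if i then b else a) else 0.
Proof. by rewrite mxE; case: i; case: j. Qed.

Lemma unit2E i j : (1%:M : 'M[C]_2) (bidx i) (bidx j) = (i == j)%:R.
Proof. by rewrite mxE; case: i; case: j. Qed.

Definition rot (a : R) : 'M[C]_2 :=
  \matrix_(i < 2, j < 2)
    if i == j then (cos a)%:C else if i == bidx false then (- sin a)%:C else (sin a)%:C.

(** The power $X^b$ of the NOT matrix: a CNOT as its target sees it, with [b] the control bit. *)
Definition notmx (b : bool) : 'M[C]_2 :=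
  \matrix_(i < 2, j < 2) ((i == j) (+) b)%:R.

Lemma notmxE b i j : notmx b (bidx i) (bidx j) = (i (+) j == b)%:R.
Proof. by rewrite mxE; case: i; case: j; case: b. Qed.

Lemma rotE a i j : rot a (bidx i) (bidx j) =
  (if i == j then cos a else if i then sin a else - sin a)%:C.
Proof. by rewrite mxE; case: i; case: j. Qed.

Lemma rotD a (a' : R) : rot a *m rot a' = rot (a + a').
Proof.
apply: bidx_mxP => i j; rewrite mul2E !rotE cosD sinD -!rmorphM -rmorphD.
by congr (_%:C); case: i; case: j => /=; ring.
Qed.

Lemma rot0 : rot 0 = 1%:M.
Proof.
by apply: bidx_mxP => i j; rewrite rotE unit2E cos0 sin0 oppr0; case: i; case: j.
Qed.

Lemma adjmx_rot a : adjmx (rot a) = rot (- a).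
Proof.
apply: bidx_mxP => i j; rewrite 2!mxE !rotE cosN sinN opprK conjc_real.
by case: i; case: j.
Qed.

Lemma rot_unitary a : qunitary (rot a).
Proof. by rewrite /qunitary adjmx_rot rotD subrr rot0. Qed.

Lemma notmxM b b' : notmx b *m notmx b' = notmx (b (+) b').
Proof.
apply: bidx_mxP => i j; rewrite mul2E !notmxE.
by case: i; case: j; case: b; case: b'; rewrite /= ?(mulr1, mul1r, mulr0, mul0r, addr0, add0r).
Qed.

Lemma notmx0 : notmx false = 1%:M.
Proof. by apply: bidx_mxP => i j; rewrite notmxE unit2E; case: i; case: j. Qed.

(** NOT is a reflection of the plane, so moving it past a rotation reverses the angle. *)
Lemma notmx_rot b a : notmx b *m rot a = rot ((-1) ^+ b * a) *m notmx b.
Proof.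
apply: bidx_mxP => i j; rewrite !mul2E !notmxE !rotE.
case: i; case: j; case: b;
  rewrite /= ?(expr0, expr1, mulN1r, cosN, sinN, mulr1, mul1r, mulr0, mul0r, addr0, add0r) //.
by rewrite opprK.
Qed.

Lemma adjmxK (A : 'M[C]_2) : adjmx (adjmx A) = A.
Proof. by apply/matrixP => i j; rewrite !mxE conjcK. Qed.

Lemma adjmx_unitary (A : 'M[C]_2) : qunitary A -> qunitary (adjmx A).
Proof. by rewrite /qunitary adjmxK; apply: mulmx1C. Qed.

Lemma adjmx_diag2 a (a' : R) :
  adjmx (diag2 (expi a) (expi a')) = diag2 (expi (- a)) (expi (- a')).
Proof.
apply: bidx_mxP => i j; rewrite 2!mxE !diag2E -!conj_expi.
by case: i; case: j => //=; rewrite /conjc oppr0.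
Qed.

Lemma diag2M (a b a' b' : C) : diag2 a b *m diag2 a' b' = diag2 (a * a') (b * b').
Proof.
apply: bidx_mxP => i j; rewrite mul2E !diag2E.
by case: i; case: j; rewrite /= ?(mulr0, mul0r, addr0, add0r).
Qed.

Lemma diag2_unitary a (a' : R) : qunitary (diag2 (expi a) (expi a')).
Proof.
rewrite /qunitary adjmx_diag2 diag2M -!expiD !subrr expi0.
by apply: bidx_mxP => i j; rewrite diag2E unit2E; case: i; case: j.
Qed.

Lemma rotN_pihalf : rot (- (pi / 2)) *m notmx true = diag2 1 (-1).
Proof.
apply: bidx_mxP => i j; rewrite mul2E !rotE !notmxE diag2E cosN sinN cos_pihalf sin_pihalf.
by case: i; case: j;
  rewrite /= ?(mulr1, mulr0, addr0, add0r, mul0r) ?opprK ?rmorphN ?rmorph0 ?rmorph1.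
Qed.

Lemma rot_pihalf : rot (pi / 2) *m notmx true = diag2 (-1) 1.
Proof.
apply: bidx_mxP => i j; rewrite mul2E !rotE !notmxE diag2E cos_pihalf sin_pihalf.
by case: i; case: j;
  rewrite /= ?(mulr1, mulr0, addr0, add0r, mul0r) ?rmorphN ?rmorph0 ?rmorph1.
Qed.

(** The rotation by $\pi/4$ stands in for a Hadamard gate: it carries the axes to the eigenlines of
    NOT, so a conditional sign becomes a conditional NOT. *)
Lemma rot_conj_diag (e : C) (b : bool) :
  rot (pi / 4) *m diag2 e ((-1) ^+ b * e) *m rot (- (pi / 4)) = e *: notmx b.
Proof.
have -> : diag2 e ((-1) ^+ b * e) = e *: (diag2 1 ((-1) ^+ b)).
  apply: bidx_mxP => i j; rewrite [RHS]mxE !diag2E.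
  by case: i; case: j; rewrite /= ?(mulr0, mulr1) // mulrC.
rewrite -scalemxAr -scalemxAl; congr (_ *: _); case: b; last first.
  have -> : diag2 1 ((-1) ^+ false : C) = 1%:M.
    by apply: bidx_mxP => i j; rewrite diag2E unit2E; case: i; case: j.
  by rewrite mulmx1 rotD subrr rot0 notmx0.
by rewrite expr1 -rotN_pihalf mulmxA rotD -mulmxA notmx_rot expr1 mulN1r opprK
  mulmxA rotD [_ + _](_ : _ = 0) ?rot0 ?mul1mx//; lra.
Qed.

End Phases.

(** * Bit strings: writing one bit and flipping a set of bits *)

Section Flips.
Variable n : nat.
Implicit Types (x y : bits n) (q : 'I_n) (A : seq 'I_n) (b : bool).

Definition flips A b x : bits n := [ffun i => x i (+) (b && (i \in A))].

Lemma setbitE x q b i : setbit x q b i = if i == q then b else x i.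
Proof. by rewrite ffunE. Qed.

Lemma setbit_eq x q b : setbit x q b q = b.
Proof. by rewrite setbitE eqxx. Qed.

Lemma setbit_neq x q b i : i != q -> setbit x q b i = x i.
Proof. by rewrite setbitE => /negPf->. Qed.

Lemma setbit_id x q : setbit x q (x q) = x.
Proof. by apply/ffunP => i; rewrite setbitE; case: eqP => [->|]. Qed.

Lemma setbit2 x q b b' : setbit (setbit x q b) q b' = setbit x q b'.
Proof. by apply/ffunP => i; rewrite !setbitE; case: eqP. Qed.

Lemma flipsE A b x i : flips A b x i = x i (+) (b && (i \in A)).
Proof. by rewrite ffunE. Qed.

Lemma flips_notin A b x i : i \notin A -> flips A b x i = x i.
Proof. by rewrite flipsE => /negPf->; rewrite andbF addbF. Qed.

Lemma flips1 q b x : flips [:: q] b x = setbit x q (x q (+) b).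
Proof.
apply/ffunP => i; rewrite flipsE setbitE inE.
by case: eqP => [->|_]; rewrite ?andbT ?andbF ?addbF.
Qed.

Lemma flipsD A b b' x : flips A b (flips A b' x) = flips A (b (+) b') x.
Proof. by apply/ffunP => i; rewrite !flipsE; case: b b' (x i) (i \in A) => [] [] [] []. Qed.

Lemma flips0 A x : flips A false x = x.
Proof. by apply/ffunP => i; rewrite flipsE addbF. Qed.

Lemma flips_setbit A b x q b' : q \notin A ->
  flips A b (setbit x q b') = setbit (flips A b x) q b'.
Proof.
move=> /negPf qA; apply/ffunP => i; rewrite !(flipsE, setbitE).
by case: eqP => // ->; rewrite qA andbF addbF.
Qed.

Lemma all_flips A b x (l : seq 'I_n) : {in l, forall q, q \notin A} ->
  all (flips A b x) l = all x l.
Proof. by move=> lA; apply: eq_in_all => q /lA; apply: flips_notin. Qed.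

Lemma all_setbit x q b (l : seq 'I_n) : q \notin l ->
  all (setbit x q b) l = all x l.
Proof.
by move=> ql; apply: eq_in_all => i il; rewrite setbit_neq //; apply: contraNneq ql => <-.
Qed.

End Flips.

(** * Monomial and block operators as meanings of circuits; inverse circuits *)

Section Semantics.
Variables (R : realType) (n : nat).
Local Notation C := R[i].
Implicit Types (x y : bits n) (q : 'I_n) (psi : state R n) (c : seq (gate R n)).
Implicit Types (f : bits n -> R) (p : bits n -> bits n) (z : bits n -> bool).

Definition indep T q (f : bits n -> T) := forall x b, f (setbit x q b) = f x.

(** Commuting with every write to [q] says that [p] leaves [q] alone and moves the other bits
    without reading it. *)
Definition fixes q p := forall x b, p (setbit x q b) = setbit (p x) q b.

(** A phase times a pull-back of indices. The phase is stored as a real angle, so composing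
    operators adds angles. *)
Definition mono f p : state R n -> state R n := fun psi x => expi (f x) * psi (p x).

(** A matrix on qubit [q] chosen by the basis state, combined with the index map [p] on the other
    bits. Blocks on the same qubit compose by matrix product as soon as the inner matrix and map
    ignore [q]. *)
Definition blk q (G : bits n -> 'M[C]_2) p : state R n -> state R n := fun psi x =>
  G x (bidx (x q)) (bidx false) * psi (setbit (p x) q false)
  + G x (bidx (x q)) (bidx true) * psi (setbit (p x) q true).

Lemma eq_mono f p f' p' : (forall x, expi (f x) = expi (f' x) :> C) -> p =1 p' ->
  mono f p = mono f' p'.
Proof. by move=> ff' pp'; apply: funext => psi; apply: funext => x; rewrite /mono ff' pp'. Qed.

Lemma eq_blk q G p G' p' : G =1 G' -> p =1 p' -> blk q G p = blk q G' p'.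
Proof. by move=> GG' pp'; apply: funext => psi; apply: funext => x; rewrite /blk GG' pp'. Qed.

Lemma mono_comp f p f' p' psi :
  mono f p (mono f' p' psi) = mono (fun x => f x + f' (p x)) (p' \o p) psi.
Proof. by apply: funext => x; rewrite /mono expiD mulrA. Qed.

Lemma blk_comp q G p G' p' psi : indep q G' -> fixes q p' ->
  blk q G p (blk q G' p' psi) = blk q (fun x => G x *m G' (p x)) (p' \o p) psi.
Proof.
move=> iG fp; apply: funext => x; rewrite /blk !iG !fp !setbit2 !setbit_eq !mul2E /=.
ring.
Qed.

Lemma mono_blk q f p : fixes q p ->
  mono f p = blk q (fun x => diag2 (expi (f (setbit x q false)))
                                   (expi (f (setbit x q true)))) p.
Proof.
move=> fp; apply: funext => psi; apply: funext => x; rewrite /blk /mono !diag2E -!fp.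
by move: (setbit_id x q); case: (x q) => /= ->; rewrite mul0r ?addr0 ?add0r.
Qed.

Lemma fixes_at q p x : fixes q p -> p x q = x q.
Proof. by move=> /(_ x (x q)); rewrite setbit_id => ->; rewrite setbit_eq. Qed.

Lemma flip_blk q f p z : fixes q p ->
  mono f (fun x => flips [:: q] (z x) (p x)) = blk q (fun x => expi (f x) *: notmx R (z x)) p.
Proof.
move=> fp; apply: funext => psi; apply: funext => x; rewrite /blk /mono !mxE flips1 fixes_at //.
by case: (x q); case: (z x); rewrite /= ?(mulr1, mulr0, mul0r, addr0, add0r).
Qed.

Lemma circ_cat c c' psi : circ_apply (c ++ c') psi = circ_apply c' (circ_apply c psi).
Proof. by rewrite /circ_apply foldl_cat. Qed.

Lemma single_blk q G : gate_apply (Single q G) = blk q (fun=> G) id.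
Proof. by []. Qed.

Lemma circ1 (g : gate R n) : circ_apply [:: g] = gate_apply g.
Proof. by []. Qed.

Lemma cnot_mono q t : gate_apply (CNOT R q t) = mono (fun=> 0) (fun x => flips [:: t] (x q) x).
Proof.
apply: funext => psi; apply: funext => x; rewrite /mono expi0 mul1r /=.
by case: ifP => xq; rewrite ?flips0 // flips1 addbT.
Qed.

Definition ginv (g : gate R n) : gate R n :=
  match g with CNOT q t => CNOT R q t | Single q G => Single q (adjmx G) end.

Definition cinv c := rev (map ginv c).

(** A recursive form of validity, convenient for concatenations; it is converted to [all_valid] only
    at the end. *)
Fixpoint cvalid c : Prop := if c is g :: c' then gate_valid g /\ cvalid c' else True.

Lemma cvalid_cat c c' : cvalid (c ++ c') <-> cvalid c /\ cvalid c'.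
Proof. by elim: c => [|g c IH] /=; tauto. Qed.

Lemma ginv_valid g : gate_valid g -> gate_valid (ginv g).
Proof. by case: g => //= q G; apply: adjmx_unitary. Qed.

Lemma cinv_valid c : cvalid c -> cvalid (cinv c).
Proof.
rewrite /cinv; elim: c => //= g c IH [vg vc]; rewrite rev_cons -cats1.
by apply/cvalid_cat; split; [apply: IH | split=> //; apply: ginv_valid].
Qed.

Lemma ginvK g psi : gate_valid g -> gate_apply (ginv g) (gate_apply g psi) = psi.
Proof.
case: g => [q t /eqP qt | q G uG]; rewrite /ginv.
  rewrite !cnot_mono mono_comp; apply: funext => x.
  have xq : flips [:: t] (x q) x q = x q by rewrite flips_notin // inE.
  by rewrite /mono addr0 expi0 mul1r /= xq flipsD addbb flips0.
rewrite !single_blk blk_comp // (mulmx1C uG); apply: funext => x; rewrite /blk !unit2E.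
by move: (setbit_id x q); case: (x q) => /= ->; rewrite mul0r mul1r ?addr0 ?add0r.
Qed.

Lemma cinvK c psi : cvalid c -> circ_apply (cinv c) (circ_apply c psi) = psi.
Proof.
rewrite /cinv; elim: c psi => //= g c IH psi [vg vc].
by rewrite rev_cons -cats1 circ_cat IH // circ1 ginvK.
Qed.

Lemma cinv_cat c c' : cinv (c ++ c') = cinv c' ++ cinv c.
Proof. by rewrite /cinv map_cat rev_cat. Qed.

Definition ncnot c := count (@is_cnot R n) c.

Lemma ncnot_cat c c' : ncnot (c ++ c') = (ncnot c + ncnot c')%N.
Proof. exact: count_cat. Qed.

Lemma ncnot_cinv c : ncnot (cinv c) = ncnot c.
Proof. by rewrite /ncnot /cinv count_rev count_map; apply: eq_count => -[]. Qed.

Lemma cinv_phase c f : cvalid c -> circ_apply c = mono f id ->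
  circ_apply (cinv c) = mono (fun x => - f x) id.
Proof.
move=> vc cf; apply: funext => psi; apply: funext => x.
rewrite -[in LHS](_ : mono f id (mono (fun x => - f x) id psi) = psi) -?cf ?cinvK //.
by rewrite cf mono_comp; apply: funext => y; rewrite /mono subrr expi0 mul1r.
Qed.

(* The phases [f] of the permutation cancel, so relative-phase circuits suffice for [V]. *)
Lemma conj_phase V D f p w w' : cvalid V -> circ_apply V = mono f p ->
  circ_apply D = mono w id -> (forall x, w x = w' (p x)) ->
  circ_apply (V ++ D ++ cinv V) = mono w' id.
Proof.
move=> vV Vf Dw ww'; apply: funext => psi; rewrite !circ_cat Dw.
rewrite -[RHS](cinvK _ vV) Vf; congr circ_apply.
by rewrite !mono_comp; apply: funext => x; rewrite /mono /= expiD ww' addrC expiD.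
Qed.

(** Seen on [q], the monomial is diagonal with relative sign $(-1)^z$, and [rot_conj_diag] turns
    that sign into a NOT controlled by [z]. *)
Lemma rot_conj_op q f p z psi : fixes q p ->
  (forall x, f (setbit x q true) = f (setbit x q false) + (z x)%:R * pi) ->
  gate_apply (Single q (rot (pi / 4)))
    (mono f p (gate_apply (Single q (rot (- (pi / 4)))) psi)) =
  mono (fun x => f (setbit x q false)) (fun x => flips [:: q] (z x) (p x)) psi.
Proof.
move=> fp fz; rewrite !single_blk (mono_blk _ fp) flip_blk //.
rewrite !blk_comp //; last by move=> x b; rewrite !setbit2.
apply: (congr1 (fun F : _ -> state R n => F psi)); apply: eq_blk => // x /=.
rewrite -rot_conj_diag fz expiD; congr (_ *m diag2 _ _ *m _).
by rewrite mulr_natl mulrC; case: (z x); rewrite /= ?mulr0n ?mulr1n ?expi0 ?expi_pi ?expr1 ?expr0.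
Qed.

Lemma rot_conj_mono c q f p z : circ_apply c = mono f p -> fixes q p ->
  (forall x, f (setbit x q true) = f (setbit x q false) + (z x)%:R * pi) ->
  circ_apply (Single q (rot (- (pi / 4))) :: c ++ [:: Single q (rot (pi / 4))]) =
  mono (fun x => f (setbit x q false)) (fun x => flips [:: q] (z x) (p x)).
Proof.
move=> cf fp fz; apply: funext => psi.
by rewrite -cat1s !circ_cat !circ1 cf (rot_conj_op _ fp fz).
Qed.

End Semantics.

Local Arguments gate_apply : simpl never.

(** * A relative-phase chain of conjunctions on borrowed qubits *)

Section Chain.
Variables (R : realType) (n : nat).
Local Notation C := R[i].
Implicit Types (x y : bits n) (c d q s t : 'I_n) (l : seq ('I_n * 'I_n)).

(** Pushing every NOT to the right reverses the angles it crosses. For [z] false everything cancels;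
    for [z] true the angles sum to $0$ if [b] holds and to $4r = \pi/2$ otherwise. This is the
    relative-phase Toffoli gate of Margolus. *)
Lemma half_toffoli (b z : bool) (r : R) : r = pi / 8 ->
  rot r *m notmx R b *m rot r *m notmx R z *m rot (- r) *m notmx R b *m rot (- r)
  = if z then (if b then notmx R true else diag2 (-1) 1) else 1%:M.
Proof.
move=> r8.
have nr b' a M : notmx R b' *m (rot a *m M) = rot ((-1) ^+ b' * a) *m (notmx R b' *m M).
  by rewrite !mulmxA notmx_rot.
have nn b' b'' M : notmx R b' *m (notmx R b'' *m M) = notmx R (b' (+) b'') *m M.
  by rewrite !mulmxA notmxM.
have rr a a' M : rot a *m (rot a' *m M) = rot (a + a') *m M :> 'M[C]_2.
  by rewrite !mulmxA rotD.
rewrite -!mulmxA !(notmx_rot, nr, rotD, rr, notmxM, nn).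
case: z; case: b; rewrite /= ?expr1 ?expr0.
- rewrite [rot _](_ : _ = 1%:M) ?mul1mx // -rot0; congr rot; ring.
- by rewrite -rot_pihalf; congr (rot _ *m _); rewrite r8; lra.
- by rewrite notmx0 mulmx1 -rot0; congr rot; ring.
- by rewrite notmx0 mulmx1 -rot0; congr rot; ring.
Qed.

Lemma cnot_blk q t : gate_apply (CNOT R q t) = blk t (fun x => notmx R (x q)) id.
Proof.
by rewrite cnot_mono (@flip_blk _ _ t _ id) //; apply: eq_blk => // x; rewrite expi0 scale1r.
Qed.

(** The index map of the chain below. The head target collects the conjunction of all the controls,
    the later targets collect partial conjunctions. *)
Fixpoint togg l x : bits n :=
  if l is (c, d) :: l' then flips [:: d] (x c && all x (unzip1 l')) (togg l' x) else x.

Lemma togg_notin l x q : q \notin unzip2 l -> togg l x q = x q.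
Proof.
elim: l => //= -[c d] l IH; rewrite inE => /norP[qd /IH <-].
by rewrite flips_notin // inE.
Qed.

Lemma all_togg l x (A : seq 'I_n) : {in A, forall q, q \notin unzip2 l} ->
  all (togg l x) A = all x A.
Proof. by move=> Al; apply: eq_in_all => q /Al; apply: togg_notin. Qed.

Lemma togg_fixes l q : q \notin unzip1 l -> q \notin unzip2 l -> fixes q (togg l).
Proof.
move=> + + x b; elim: l => //= -[c d] l IH /=; rewrite !inE => /norP[qc q1] /norP[qd q2].
by rewrite IH // all_setbit // setbit_neq 1?eq_sym // flips_setbit // inE.
Qed.

Definition half_and c d : seq (gate R n) :=
  [:: Single d (rot (- (pi / 8))); CNOT R c d; Single d (rot (- (pi / 8)))].

(* Four CNOTs per extra control: a relative-phase Toffoli and its inverse would cost six,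
   but their facing halves cancel because only [d'] changes in between. *)
Fixpoint chain l : seq (gate R n) :=
  if l is (c, d) :: l' then
    if l' is (_, d') :: _ then
      half_and c d ++ (CNOT R d' d :: chain l' ++ [:: CNOT R d' d])
        ++ cinv (half_and c d)
    else [:: CNOT R c d]
  else [::].

Lemma indep_flips T q (f : bits n -> T) b x : indep q f -> f (flips [:: q] b x) = f x.
Proof. by rewrite flips1 => ->. Qed.

Lemma fixes_flips q (p : bits n -> bits n) b x : fixes q p ->
  p (flips [:: q] b x) = flips [:: q] b (p x).
Proof. by move=> fp; rewrite !flips1 fp fixes_at. Qed.

(** Induction from the far end of the chain. Independence of [f] from outside qubits is carried
    along because the phase of the inner chain must act as a scalar on the block of the next target
    [d]. *)
Lemma chain_mono l : uniq (unzip1 l ++ unzip2 l) ->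
  exists2 f, forall q, q \notin unzip1 l ++ unzip2 l -> indep q f
           & circ_apply (chain l) = mono f (togg l).
Proof.
elim: l => [|[c d] l IH].
  exists (fun=> 0) => //; apply: funext => psi; apply: funext => x.
  by rewrite /mono expi0 mul1r.
rewrite cat_uniq /= => /and3P[/andP[c1 u1] /norP[d1 ud] /andP[d2 u2]].
have [f fi lf] : exists2 f, forall q, q \notin unzip1 l ++ unzip2 l -> indep q f
           & circ_apply (chain l) = mono f (togg l).
  apply: IH; rewrite cat_uniq u1 u2 andbT; apply: contraNN ud.
  by apply: sub_has => q /= ql; rewrite inE ql orbT.
have [cd dl1 c2] : [/\ c != d, d \notin unzip1 l & c \notin unzip2 l].
  move: d1; rewrite inE negb_or eq_sym => /andP[-> ->]; split=> //.
  by apply: contraNN ud => cl; apply/hasP; exists c => //=; rewrite inE eqxx.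
have fd : indep d f by apply: fi; rewrite mem_cat (negPf d2) orbF.
case: l lf IH fi c1 c2 u1 ud d1 d2 u2 dl1 => [|[c0 d'] l'] lf _ fi c1 c2 u1 ud d1 d2 u2 dl1.
  exists (fun=> 0) => //; rewrite -[LHS]/(gate_apply (CNOT R c d)) cnot_mono.
  by apply: eq_mono => // x /=; rewrite andbT.
set l := _ :: l' in lf fi c1 c2 u1 ud d1 d2 u2 dl1 *.
pose a x := all x (unzip1 l).
have ai q : q \notin unzip1 l -> indep q a by move=> ql x b; apply: all_setbit.
have d'P x : togg l x d' = x d' (+) a x.
  by rewrite /= flips1 setbit_eq togg_notin //; case/andP: (u2 : uniq (d' :: unzip2 l')).
have dd' : d != d' by move: d2; rewrite inE negb_or => /andP[].
(* [d'] is added to [d] before and after the inner chain, which changes it by [a]; the net effect on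
   [d] is [a] alone, so the initial value of [d'] is arbitrary. *)
have mid : circ_apply (CNOT R d' d :: chain l ++ [:: CNOT R d' d]) =
           blk d (fun x => expi (f x) *: notmx R (a x)) (togg l).
  clearbody l; rewrite -flip_blk; last exact: togg_fixes.
  rewrite -cat1s; apply: funext => psi; rewrite !circ_cat !circ1 cnot_mono lf !mono_comp.
  apply: (congr1 (fun F : _ -> state R n => F psi)); apply: eq_mono => x /=.
    by rewrite add0r addr0 indep_flips.
  rewrite fixes_flips; last exact: togg_fixes.
  rewrite flipsD flips_notin ?d'P ?inE 1?eq_sym 1?addbAC ?addbA ?addbb //.
rewrite -[circ_apply _]/(circ_apply (half_and c d ++
  (CNOT R d' d :: chain l ++ [:: CNOT R d' d]) ++ cinv (half_and c d))).
clearbody l.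
(* The extra [pi] is the entry $-1$ of [diag2 (-1) 1], met when [a] holds while [c] and [d] are both
   0. *)
exists (fun x => f x + (if a x && ~~ x c && ~~ x d then pi else 0)).
  move=> q; rewrite -cat_cons mem_cat !inE !negb_or -!andbA => /and4P[qc q1 qd q2] x b.
  by rewrite ai // fi ?setbit_neq // 1?eq_sym // mem_cat negb_or q1.
have al : indep d a by apply: ai.
have tl : fixes d (togg l) by apply: togg_fixes.
have tc x : togg l x c = x c by rewrite togg_notin.
apply: funext => psi.
have tl1 x : togg l x d = x d by rewrite fixes_at.
rewrite !circ_cat mid /cinv /half_and /circ_apply /= .
rewrite adjmx_rot opprK !cnot_blk !single_blk.
have ic : indep d (fun x => notmx R (x c)) by move=> x b; rewrite setbit_neq.
have im : indep d (fun x => expi (f x) *: notmx R (a x)).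
  by move=> x b; rewrite fd al.
rewrite !blk_comp //.
rewrite (_ : blk _ _ _ = blk d (fun x => expi (f x) *:
  if a x then (if x c then notmx R true else diag2 (-1) 1) else 1%:M) (togg l)); last first.
  apply: eq_blk => // x /=; rewrite tc -(half_toffoli _ _ (erefl (pi / 8))).
  by rewrite -scalemxAr -!scalemxAl.
apply: funext => x; rewrite /blk /mono -/(a x) flips1 tl1 !mxE.
move: (setbit_id (togg l x) d) (@expi_pi R); rewrite tl1; move: (pi : R) => pi' xd epi.
case: (a x); case: (x c); rewrite !(notmxE, diag2E, unit2E); case: (x d) xd => /= xd;
  rewrite ?(mulr1, mulr0, mul0r, addr0, add0r) ?xd ?expiD ?epi //.
Qed.
End Chain.

(** * Exact multi-controlled NOT from the chain and a commutator *)

Section Toffoli.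
Variables (R : realType) (n : nat).
Local Notation C := R[i].
Implicit Types (x y : bits n) (c d q s t : 'I_n) (l : seq ('I_n * 'I_n)).

(** One CNOT for the last pair and four for each other pair. *)
Lemma ncnot_chain l : l != [::] -> (ncnot (chain R l) + 3 = 4 * size l)%N.
Proof.
elim: l => // -[c d] [|[c0 d'] l] // IH _.
have {}IH := IH isT.
have -> : chain R ((c, d) :: (c0, d') :: l) =
  half_and R c d ++ ([:: CNOT R d' d] ++ chain R ((c0, d') :: l) ++ [:: CNOT R d' d])
    ++ cinv (half_and R c d) by [].
rewrite !ncnot_cat ncnot_cinv; have -> : ncnot (half_and R c d) = 1%N by [].
have -> : ncnot [:: CNOT R d' d] = 1%N by [].
by move: IH => /=; lia.
Qed.

Lemma chain_valid l : uniq (unzip1 l ++ unzip2 l) -> cvalid (chain R l).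
Proof.
elim: l => // -[c d] l IH; rewrite cat_uniq /= => /and3P[/andP[c1 u1] /norP[d1 ud] /andP[d2 u2]].
have vl : cvalid (chain R l).
  apply: IH; rewrite cat_uniq u1 u2 andbT; apply: contraNN ud.
  by apply: sub_has => q /= ql; rewrite inE ql orbT.
have cd : c <> d by move=> cd; rewrite cd inE eqxx in d1.
case: l vl {IH c1 u1 ud u2 d1} d2 => [|[c0 d'] l'] vl //= d2.
have d'd : d' <> d by move=> dd; rewrite dd inE eqxx in d2.
have ur := @rot_unitary R (- (pi / 8)).
do 4 (split=> //); apply/cvalid_cat; split.
  by apply/cvalid_cat.
by apply: cinv_valid.
Qed.

Lemma diag_mono q (a0 a1 : R) :
  gate_apply (Single q (diag2 (expi a0) (expi a1))) = mono (fun x => if x q then a1 else a0) id.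
Proof.
rewrite (@mono_blk _ _ q) //; apply: eq_blk => // x.
by rewrite !setbit_eq.
Qed.

Definition comm (u1 u2 r r' : seq (gate R n)) := r ++ u1 ++ r' ++ u2 ++ r ++ u1 ++ r' ++ u2.

(** With $s_i = (-1)^{a_i}$, the accumulated angle is $g(1 - s_1 - s_2 + s_1 s_2) =
    g(1-s_1)(1-s_2)$, which is $4g$ when both conditions hold and 0 otherwise. *)
Lemma comm_mono u1 u2 r r' (g : bits n -> R) (a1 a2 : bits n -> bool) p1 p2 :
  circ_apply u1 = mono (fun=> 0) p1 -> circ_apply u2 = mono (fun=> 0) p2 ->
  circ_apply r = mono g id -> circ_apply r' = mono (fun x => - g x) id ->
  (forall x, g (p1 x) = (-1) ^+ (a1 x) * g x) ->
  (forall x, g (p2 x) = (-1) ^+ (a2 x) * g x) ->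
  (forall x, (a1 (p1 x) = a1 x) * (a2 (p1 x) = a2 x)) ->
  (forall x, (a1 (p2 x) = a1 x) * (a2 (p2 x) = a2 x)) ->
  (forall x, p1 (p2 (p1 (p2 x))) = x) ->
  circ_apply (comm u1 u2 r r') = mono (fun x => (a1 x && a2 x)%:R * (4 * g x)) id.
Proof.
move=> cu1 cu2 cr cr' g1 g2 i1 i2 K; apply: funext => psi.
rewrite !circ_cat cu1 cu2 cr cr' !mono_comp; apply: (congr1 (fun F : _ -> state R n => F psi)).
apply: eq_mono => x /=; rewrite ?K //; congr expi.
rewrite !(g1, g2, i1, i2).
by case: (a1 x); case: (a2 x); rewrite /= ?expr1 ?expr0; ring.
Qed.

Definition zrot (a : R) q : gate R n := Single q (diag2 (expi a) (expi (- a))).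

Lemma zrot_mono a q : gate_apply (zrot a q) = mono (fun x => (-1) ^+ (x q) * a) id.
Proof.
rewrite diag_mono; apply: eq_mono => // x.
by case: (x q); rewrite ?expr1 ?expr0 ?mul1r ?mulN1r.
Qed.

(* [exp (i pi/2 c s (-1)^d)]: only the part of a doubly-controlled sign that feels [d]. *)
Definition half_ccz c s d : seq (gate R n) :=
  comm [:: CNOT R c d] [:: CNOT R s d] [:: zrot (pi / 8) d] [:: zrot (- (pi / 8)) d].

Lemma half_ccz_mono c s d : c != d -> s != d ->
  circ_apply (half_ccz c s d) = mono (fun x => (x c && x s)%:R * ((-1) ^+ (x d) * (pi / 2))) id.
Proof.
move=> cd sd.
have fl q b x : q != d -> flips [:: d] b x q = x q by move=> qd; rewrite flips_notin // inE.
rewrite (comm_mono (u1 := [:: CNOT R c d]) (u2 := [:: CNOT R s d]) (r := [:: zrot (pi / 8) d])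
          (g := fun x => (-1) ^+ (x d) * (pi / 8)) (a1 := fun x => x c) (a2 := fun x => x s)
          (cnot_mono R c d) (cnot_mono R s d) (zrot_mono (pi / 8) d)) //.
- by apply: eq_mono => // x; congr (expi (_ * _)); lra.
- by rewrite [LHS]zrot_mono; apply: eq_mono => // x; rewrite mulrN.
- by move=> x; rewrite flips1 setbit_eq addbC signr_addb mulrA.
- by move=> x; rewrite flips1 setbit_eq addbC signr_addb mulrA.
- by move=> x; rewrite !fl.
- by move=> x; rewrite !fl.
- by move=> x; rewrite !fl // !flipsD; case: (x c); case: (x s); rewrite flips0.
Qed.

(** Comparing [W] before and after the chain has toggled its target isolates the part of the phase
    that depends on the conjunction. The default [s] of [head] only concerns an empty [l]. *)
Definition mcx c l s : seq (gate R n) :=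
  let W := half_ccz c s (head s (unzip2 l)) in
  Single s (rot (- (pi / 4)))
    :: (chain R l ++ W ++ cinv (chain R l) ++ cinv W) ++ [:: Single s (rot (pi / 4))].

(** Two chains and two copies of [half_ccz], the latter with four CNOTs each. *)
Lemma ncnot_mcx c l s : l != [::] -> (ncnot (mcx c l s) + 6 = 8 * (size l).+1)%N.
Proof.
move=> /ncnot_chain; rewrite /mcx -cat1s !ncnot_cat !ncnot_cinv /ncnot /=; lia.
Qed.

Lemma half_ccz_valid c s d : c != d -> s != d -> cvalid (half_ccz c s d).
Proof.
have uz a := diag2_unitary a (- a : R).
by move=> /eqP cd /eqP sd; rewrite /half_ccz /comm /zrot /=; do ?split.
Qed.

Lemma head_mem l s : l != [::] -> head s (unzip2 l) \in unzip2 l.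
Proof. by case: l => // -[c d] l _; rewrite inE eqxx. Qed.

Lemma togg_head l x s : l != [::] -> uniq (unzip2 l) ->
  togg l x (head s (unzip2 l)) = x (head s (unzip2 l)) (+) all x (unzip1 l).
Proof.
case: l => // -[c d] l _ /= /andP[d2 _].
by rewrite flips1 setbit_eq togg_notin.
Qed.

Lemma mcx_valid c l s : l != [::] -> uniq (c :: s :: unzip1 l ++ unzip2 l) ->
  cvalid (mcx c l s).
Proof.
move=> /(head_mem s) dl.
rewrite cons_uniq cons_uniq inE !mem_cat !negb_or => /and3P[/and3P[cs c1 c2] /andP[s1 s2] ul].
have vW : cvalid (half_ccz c s (head s (unzip2 l))).
  by apply: half_ccz_valid; [apply: contraNneq c2 | apply: contraNneq s2] => ->.
have vV := chain_valid ul.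
have vr a : cvalid [:: Single s (rot (a : R))] by split=> //; apply: rot_unitary.
have [cV cW] := (cinv_valid vV, cinv_valid vW).
have [r1 r2] := (vr (- (pi / 4)), vr (pi / 4)).
rewrite /mcx -cat1s; apply/cvalid_cat; split=> //.
apply/cvalid_cat; split=> //; apply/cvalid_cat; split=> //.
by apply/cvalid_cat; split=> //; apply/cvalid_cat.
Qed.

Lemma mcx_mono c l s : l != [::] -> uniq (c :: s :: unzip1 l ++ unzip2 l) ->
  circ_apply (mcx c l s) =
  mono (fun=> 0) (fun x => flips [:: s] (x c && all x (unzip1 l)) x).
Proof.
move=> l0; have := head_mem s l0; rewrite /mcx; move Ed: (head _ _) => d dl.
rewrite cons_uniq cons_uniq inE !mem_cat !negb_or => /and3P[/and3P[cs c1 c2] /andP[s1 s2] ul].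
have vV := chain_valid ul.
have [f _ Vf] := chain_mono R ul.
have [cd sd] : c != d /\ s != d.
  by split; [apply: contraNneq c2 | apply: contraNneq s2] => ->.
have vW := half_ccz_valid cd sd.
have Wf := half_ccz_mono cd sd.
have td x : togg l x d = x d (+) all x (unzip1 l).
  by rewrite -Ed togg_head //; move: ul; rewrite cat_uniq => /and3P[].
have ta x : all (togg l x) (unzip1 l) = all x (unzip1 l).
  apply: all_togg => q q1; apply: contraTN ul => q2.
  by rewrite cat_uniq; apply/negP => /and3P[_ /hasPn/(_ q q2)/=]; rewrite q1.
have a_s x b : all (setbit x s b) (unzip1 l) = all x (unzip1 l) by apply: all_setbit.
have Df := conj_phase (w' := fun x => (x c && x s)%:R *
  ((-1) ^+ (x d (+) all x (unzip1 l)) * (pi / 2))) vV Vf Wf.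
(* With $a$ the conjunction over [unzip1 l], the two copies of [W] leave $\frac{\pi}{2}((-1)^{d+a} -
   (-1)^d)$ when [c] and [s] hold. This is 0 if $a$ fails and $\pm\pi$ otherwise, and both signs
   give the phase $-1$. *)
have {}Df : circ_apply (chain R l ++ half_ccz c s d ++ cinv (chain R l) ++ cinv (half_ccz c s d))
  = mono (fun x => (x c && x s && all x (unzip1 l))%:R * pi) id.
  apply: funext => psi; rewrite catA catA -(catA (chain R l)) circ_cat Df; last first.
    by move=> x; rewrite td ta (togg_notin _ c2) (togg_notin _ s2) -addbA addbb addbF.
  rewrite (cinv_phase vW Wf) mono_comp; apply: (congr1 (fun F : _ -> state R n => F psi)).
  apply: eq_mono => // x /=.
  case: (x c); case: (x s); rewrite ?mul0r ?oppr0 ?addr0 //= !mul1r.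
  case: (all _ _); rewrite ?addbT ?addbF ?mul0r ?addNr // mul1r.
  case: (x d); rewrite /= ?expr1 ?expr0 ?mulN1r ?mul1r ?opprK.
    by congr expi; lra.
  by rewrite expi_pi -(@expiNpi R); congr expi; lra.
(* The phase is now a fully controlled sign, symmetric in [s] and the controls; rotating [s] makes
   it a NOT on [s]. *)
rewrite (rot_conj_mono (z := fun x => x c && all x (unzip1 l)) Df) //.
  by apply: eq_mono => // x; rewrite setbit_eq andbF mul0r.
by move=> x; rewrite !setbit_eq !a_s !setbit_neq // andbF andbT mul0r add0r.
Qed.

End Toffoli.

(** * Joint flips of the register and its doubly controlled Z-rotations *)

Section MultiTarget.
Variables (R : realType) (n : nat).
Local Notation C := R[i].
Implicit Types (x y : bits n) (c d q s t r : 'I_n) (l : seq ('I_n * 'I_n)).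
Implicit Types (rs reg : seq 'I_n).

Definition fan s rs : seq (gate R n) := [seq CNOT R s r | r <- rs].

Lemma circ0 : circ_apply [::] = mono (R := R) (n := n) (fun=> 0) id.
Proof. by apply: funext => psi; apply: funext => x; rewrite /mono expi0 mul1r. Qed.

Lemma fan_mono s rs : s \notin rs -> uniq rs ->
  circ_apply (fan s rs) = mono (fun=> 0) (fun x => flips rs (x s) x).
Proof.
elim: rs => [|r rs IH]; first by move=> _ _; rewrite circ0; apply: eq_mono => // x;
  apply/ffunP => i; rewrite flipsE andbF addbF.
rewrite inE negb_or => /andP[sr srs] /= /andP[rrs urs]; apply: funext => psi.
rewrite -cat1s circ_cat IH // circ1 cnot_mono mono_comp.
apply: (congr1 (fun F : _ -> state R n => F psi)); apply: eq_mono => x /=; first by rewrite addr0.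
rewrite (flips_notin _ _ srs); apply/ffunP => i; rewrite !flipsE !inE.
by case: eqP => [->|_]; rewrite ?(negPf rrs) ?andbF ?addbF ?orbF ?andbT.
Qed.

(** The second fan-out undoes the first except for the change of [s] in between, so all of [rs]
    flips along with [s] at the price of one [mcx]. *)
Definition mtog c l s rs := fan s rs ++ mcx R c l s ++ fan s rs.

Lemma mtog_uniq c l s rs : uniq ((s :: rs) ++ c :: unzip1 l ++ unzip2 l) ->
  [/\ s \notin rs, uniq rs, uniq (c :: s :: unzip1 l ++ unzip2 l)
    & {in c :: unzip1 l, forall q, q \notin s :: rs}].
Proof.
rewrite cat_uniq => /and3P[+ /hasPn hd] => /= /andP[srs urs] /andP[cl ul].
split=> //.
  have sN q : q \in c :: unzip1 l ++ unzip2 l -> q != s.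
    by move=> /hd /=; rewrite inE negb_or => /andP[].
  rewrite ul inE negb_or sN ?inE ?eqxx // cl /= andbT.
  by apply: contraT => /negbNE sl; have := sN s; rewrite inE sl orbT eqxx => /(_ isT).
move=> q qc; apply: hd; move: qc; rewrite !inE mem_cat => /orP[->//|->].
by rewrite orbT.
Qed.

Lemma mtog_mono c l s rs : l != [::] ->
  uniq ((s :: rs) ++ c :: unzip1 l ++ unzip2 l) ->
  circ_apply (mtog c l s rs) =
  mono (fun=> 0) (fun x => flips (s :: rs) (all x (c :: unzip1 l)) x).
Proof.
move=> l0 /mtog_uniq[srs urs uc dj]; apply: funext => psi.
rewrite !circ_cat fan_mono // mcx_mono // !mono_comp.
apply: (congr1 (fun F : _ -> state R n => F psi)); apply: eq_mono => x; first by rewrite /= !addr0.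
pose a y := y c && all y (unzip1 l).
rewrite /= -!/(a _).
have af (A : seq 'I_n) b y : {subset A <= s :: rs} -> a (flips A b y) = a y.
  by move=> As; apply: (@all_flips _ _ _ _ (c :: unzip1 l)) => q /dj; apply: contraNN => /As.
rewrite af; last by move=> q; rewrite inE => ->; rewrite orbT.
apply/ffunP => i; rewrite !flipsE !inE eqxx (negPf srs).
case: eqP => [->|_]; rewrite ?(negPf srs) ?andbF ?addbF ?orbF ?andbT //.
by case: (i \in rs); case: (x s); case: (x i); case: (a x).
Qed.

(** Up to an additive constant, these are the angles $\pi x_r / 2^j$ of adding 1 in the Fourier
    basis, where $j$ is the number of qubits after [r]. Centring them makes a flip of the whole
    register a change of sign. *)
Fixpoint gval reg x : R :=
  if reg is r :: rs then - (pi / 2 ^+ (size rs).+1) * (-1) ^+ (x r) + gval rs x else 0.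

Fixpoint rzs (k : R) reg : seq (gate R n) :=
  if reg is r :: rs then zrot (k * - (pi / 2 ^+ (size rs).+1)) r :: rzs k rs else [::].

Lemma rzs_mono k reg : circ_apply (rzs k reg) = mono (fun x => k * gval reg x) id.
Proof.
elim: reg => [|r rs IH].
  by rewrite circ0; apply: eq_mono => // x; rewrite mulr0.
apply: funext => psi; rewrite -[rzs _ _]/([:: zrot _ r] ++ rzs k rs).
rewrite circ_cat circ1 IH zrot_mono mono_comp.
apply: (congr1 (fun F : _ -> state R n => F psi)); apply: eq_mono => x //=.
by congr expi; ring.
Qed.

Lemma gval_flips reg (A : seq 'I_n) b x : {subset reg <= A} ->
  gval reg (flips A b x) = (-1) ^+ b * gval reg x.
Proof.
elim: reg => [|r rs IH] rA /=; first by rewrite mulr0.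
rewrite IH; last by move=> q qr; apply: rA; rewrite inE qr orbT.
rewrite flipsE rA ?inE ?eqxx // andbT addbC signr_addb; ring.
Qed.

(** The factor 1/4 compensates the 4 produced by the commutator. *)
Definition mrot c1 l1 c2 l2 reg : seq (gate R n) :=
  if reg is s :: rs then
    comm (mtog c1 l1 s rs) (mtog c2 l2 s rs) (rzs (1 / 4) reg) (rzs (- (1 / 4)) reg)
  else [::].

Lemma mrot_mono c1 l1 c2 l2 reg :
  l1 != [::] -> l2 != [::] ->
  uniq (reg ++ c1 :: unzip1 l1 ++ unzip2 l1) ->
  uniq (reg ++ c2 :: unzip1 l2 ++ unzip2 l2) ->
  circ_apply (mrot c1 l1 c2 l2 reg) =
  mono (fun x => (all x (c1 :: unzip1 l1) && all x (c2 :: unzip1 l2))%:R * gval reg x) id.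
Proof.
case: reg => [|s rs] n1 n2 U1 U2.
  by rewrite circ0; apply: eq_mono => // x; rewrite mulr0.
have [_ _ _ d1] := mtog_uniq U1; have [_ _ _ d2] := mtog_uniq U2.
have r4 := rzs_mono (1 / 4) (s :: rs).
have r4' : circ_apply (rzs (- (1 / 4)) (s :: rs)) = mono (fun x => - (1 / 4 * gval (s :: rs) x)) id.
  by rewrite rzs_mono; apply: eq_mono => // x; rewrite mulNr.
rewrite (comm_mono (a1 := fun x => all x (c1 :: unzip1 l1)) (a2 := fun x => all x (c2 :: unzip1 l2))
  (mtog_mono n1 U1) (mtog_mono n2 U2) r4 r4').
- by apply: eq_mono => // x; congr expi; field.
- by move=> x; rewrite gval_flips //; ring.
- by move=> x; rewrite gval_flips //; ring.
- by move=> x; split; apply: all_flips.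
- by move=> x; split; apply: all_flips.
- move=> x; rewrite !flipsD !(all_flips _ _ d1, all_flips _ _ d2).
  by case: (all _ _); case: (all _ _); rewrite flips0.
Qed.

Lemma ncnot_fan s rs : ncnot (fan s rs) = size rs.
Proof. by elim: rs => //= r rs; rewrite /ncnot /= add1n => ->. Qed.

Lemma ncnot_rzs k reg : ncnot (rzs k reg) = 0%N.
Proof. by elim: reg. Qed.

Lemma ncnot_mrot c1 l1 c2 l2 s rs : l1 != [::] -> l2 != [::] ->
  (ncnot (mrot c1 l1 c2 l2 (s :: rs)) + 24
   = 16 * ((size l1).+1 + (size l2).+1) + 8 * size rs)%N.
Proof.
move=> n1 n2; have := ncnot_mcx R c1 s n1; have := ncnot_mcx R c2 s n2.
rewrite /mrot /comm /mtog !ncnot_cat !ncnot_rzs !ncnot_fan; lia.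
Qed.

Lemma rzs_valid k reg : cvalid (rzs k reg).
Proof. by elim: reg => //= r rs IH; split=> //; apply: diag2_unitary. Qed.

Lemma fan_valid s rs : s \notin rs -> cvalid (fan s rs).
Proof.
elim: rs => //= r rs IH; rewrite inE negb_or => /andP[/eqP sr /IH]; by split.
Qed.

Lemma mtog_valid c l s rs : l != [::] ->
  uniq ((s :: rs) ++ c :: unzip1 l ++ unzip2 l) -> cvalid (mtog c l s rs).
Proof.
move=> l0 /mtog_uniq[srs urs uc dj].
apply/cvalid_cat; split; first exact: fan_valid.
by apply/cvalid_cat; split; [apply: mcx_valid | apply: fan_valid].
Qed.

Lemma comm_valid (u1 u2 r r' : seq (gate R n)) :
  cvalid u1 -> cvalid u2 -> cvalid r -> cvalid r' -> cvalid (comm u1 u2 r r').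
Proof. by move=> *; do 7 (apply/cvalid_cat; split=> //). Qed.

Lemma mrot_valid c1 l1 c2 l2 reg :
  l1 != [::] -> l2 != [::] ->
  uniq (reg ++ c1 :: unzip1 l1 ++ unzip2 l1) ->
  uniq (reg ++ c2 :: unzip1 l2 ++ unzip2 l2) ->
  cvalid (mrot c1 l1 c2 l2 reg).
Proof.
case: reg => // s rs n1 n2 U1 U2.
by apply: comm_valid; do ?[exact: mtog_valid | exact: rzs_valid].
Qed.

End MultiTarget.

(** * Fourier addition of a controlled bit to the register *)

Section Adder.
Variables (R : realType) (n : nat).
Local Notation C := R[i].
Implicit Types (x y : bits n) (c d q s t r : 'I_n) (l rs : seq 'I_n) (a : bits n -> bool).

(** Uses $2 x_s x_r = x_s + x_r - (x_s \oplus x_r)$: two CNOTs expose the exclusive or, and all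
    other terms are single-qubit phases. *)
Definition cphase s r (a0 a1 : R) : seq (gate R n) :=
  let b := (a1 - a0) / 2 in
  [:: Single r (diag2 (expi 0) (expi (a0 + b))); Single s (diag2 (expi 0) (expi b));
      CNOT R s r; Single r (diag2 (expi 0) (expi (- b))); CNOT R s r].

Lemma cphase_mono s r (a0 a1 : R) : s != r ->
  circ_apply (cphase s r a0 a1) =
  mono (fun x => (if x s then a1 else a0) * (x r)%:R) id.
Proof.
move=> sr; apply: funext => psi; rewrite /circ_apply /cphase /=.
rewrite !cnot_mono !diag_mono !mono_comp.
apply: (congr1 (fun F : _ -> state R n => F psi)).
have fs x b : flips [:: r] b x s = x s by rewrite flips_notin // inE.
apply: eq_mono => x /=; rewrite !fs ?flipsD ?addbb ?flips0 //; congr expi.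
rewrite flips1 setbit_eq.
by case: (x s); case: (x r) => /=; field.
Qed.

Lemma cphase_valid s r (a0 a1 : R) : s != r -> cvalid (cphase s r a0 a1).
Proof. by move=> /eqP sr; do !split=> //; apply: diag2_unitary. Qed.

Fixpoint regval l x : R :=
  if l is r :: rs then (x r)%:R * 2 ^+ size rs + regval rs x else 0.

Fixpoint cval s (a0 a1 : R) l : seq (gate R n) :=
  if l is r :: rs then
    cphase s r (a0 * 2 ^+ size rs) (a1 * 2 ^+ size rs) ++ cval s a0 a1 rs
  else [::].

Lemma cval_mono s (a0 a1 : R) l : s \notin l ->
  circ_apply (cval s a0 a1 l) = mono (fun x => (if x s then a1 else a0) * regval l x) id.
Proof.
elim: l => [_|r l IH].
  by rewrite circ0; apply: eq_mono => // x; rewrite mulr0.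
rewrite inE negb_or => /andP[sr sl]; apply: funext => psi.
rewrite circ_cat cphase_mono // IH // mono_comp.
apply: (congr1 (fun F : _ -> state R n => F psi)); apply: eq_mono => x //=; congr expi.
by case: (x s); ring.
Qed.

Lemma cval_valid s (a0 a1 : R) l : s \notin l -> cvalid (cval s a0 a1 l).
Proof.
elim: l => // r l IH; rewrite inE negb_or => /andP[sr /IH vl].
by apply/cvalid_cat; split=> //; apply: cphase_valid.
Qed.

Lemma ncnot_cval s (a0 a1 : R) l : ncnot (cval s a0 a1 l) = (2 * size l)%N.
Proof.
elim: l => // r l IH.
rewrite [ncnot _](ncnot_cat (cphase _ _ _ _) (cval _ _ _ _)) IH /ncnot /=; lia.
Qed.

Lemma regval_setbit l x q b : q \notin l -> regval l (setbit x q b) = regval l x.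
Proof.
elim: l => //= r l IH; rewrite inE negb_or => /andP[qr ql].
by rewrite IH // setbit_neq // eq_sym.
Qed.

(* Since circuits act on amplitudes by pull-back, a circuit subtracting [a x] from the
   register as a map on indices adds [a x] as a map on basis states. *)
Fixpoint dec a l x : bits n :=
  if l is r :: rs then
    let y := dec a rs x in flips [:: r] (a x && all y rs) y
  else x.

Lemma dec_fixes a l q : indep q a -> q \notin l -> fixes q (dec a l).
Proof.
move=> ia + x b; elim: l => //= r l IH; rewrite inE negb_or => /andP[qr ql].
by rewrite IH // ia all_setbit // flips_setbit // inE.
Qed.

Lemma dec_notin a l q x : q \notin l -> dec a l x q = x q.
Proof.
elim: l => //= r l IH; rewrite inE negb_or => /andP[qr ql].
by rewrite flips_notin ?inE // IH.
Qed.

(** Subtraction modulo $2^m$, with $m$ the length of [l]: the decremented register is all ones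
    exactly when it wrapped around from 0. The carry is thus read off the result, as is needed when
    the phase is expressed at the new index. *)
Lemma regval_dec a l x : uniq l ->
  regval l (dec a l x) + (a x)%:R = regval l x + (a x && all (dec a l x) l)%:R * 2 ^+ size l.
Proof.
elim: l => [_|r l IH] /=; first by rewrite andbT mulr1.
move=> /andP[rl /IH]; set y := dec a l x => yE.
rewrite flips1 regval_setbit // all_setbit // setbit_eq.
have xr : y r = x r by rewrite /y dec_notin.
move: yE; rewrite -xr exprS; case: (a x); case: (all y l); case: (y r) => /= yE;
  rewrite ?mul0r ?mul1r ?add0r ?addr0 in yE *; lra.
Qed.

(** The quantum Fourier transform, most significant qubit first and without bit reversal, with
    [rot (- (pi / 4))] in place of each Hadamard gate. *)
Fixpoint qf l : seq (gate R n) :=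
  if l is r :: rs then
    Single r (rot (- (pi / 4))) :: cval r 0 (pi / 2 ^+ size rs) rs ++ qf rs
  else [::].

Lemma qf_valid l : uniq l -> cvalid (qf l).
Proof.
elim: l => //= r l IH /andP[rl /IH vl]; split; first exact: rot_unitary.
by apply/cvalid_cat; split=> //; apply: cval_valid.
Qed.

Lemma ncnot_qf l : (ncnot (qf l) + size l = size l ^ 2)%N.
Proof.
elim: l => // r l IH; rewrite -[qf _]/([:: _] ++ _ ++ qf l) !ncnot_cat ncnot_cval.
by rewrite [ncnot [:: _]]/ncnot /=; lia.
Qed.

Definition gtarget (g : gate R n) := match g with CNOT _ t => t | Single q _ => q end.

(** A gate changes only its target, so a phase that ignores all targets is constant along the
    circuit. It may still depend on qubits that serve only as controls. *)
Lemma circ_phaseC (c : seq (gate R n)) (f : bits n -> R) psi :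
  {in map gtarget c, forall q, indep q f} ->
  circ_apply c (mono f id psi) = mono f id (circ_apply c psi).
Proof.
elim: c psi => // g c IH psi fc.
rewrite -[circ_apply _ _]/(circ_apply c (gate_apply g (mono f id psi))).
have -> : gate_apply g (mono f id psi) = mono f id (gate_apply g psi).
  have {}fc := fc (gtarget g) (mem_head _ _).
  apply: funext => x; case: g fc => [q t | q G] /= fc.
    by rewrite /gate_apply /mono; case: ifP => // _; rewrite fc.
  by rewrite /gate_apply /mono !fc /=; ring.
by rewrite IH // => q qc; apply: fc; rewrite inE qc orbT.
Qed.

Lemma cval_target s (a0 a1 : R) l : {subset map gtarget (cval s a0 a1 l) <= s :: l}.
Proof.
elim: l => // r l IH q; rewrite map_cat mem_cat !inE => /orP[|/IH].
  by case/or4P=> [/eqP->|/eqP->|/eqP->|/orP[/eqP->|/eqP->]]; rewrite eqxx ?orbT.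
by rewrite inE => /orP[->|->]; rewrite ?orbT.
Qed.

Lemma qf_target l : {subset map gtarget (qf l) <= l}.
Proof.
elim: l => // r l IH q; rewrite [map _ _]/= inE map_cat mem_cat.
by case/or3P=> [/eqP->|/cval_target|/IH]; rewrite inE ?eqxx // => ->; rewrite orbT.
Qed.

Lemma cinv_target (c : seq (gate R n)) : map gtarget (cinv c) = rev (map gtarget c).
Proof. by rewrite /cinv map_rev -map_comp; congr rev; apply: eq_map => -[]. Qed.

(** Induction on the most significant qubit [r]: the lower qubits are decremented, and the change of
    their value, seen through the controlled phases between [r] and them, supplies the borrow into
    [r]. *)
Lemma qf_conj a l : uniq l -> {in l, forall q, indep q a} ->
  exists k : R, forall psi,
    circ_apply (cinv (qf l))
      (mono (fun x => (a x)%:R * gval R l x) id (circ_apply (qf l) psi))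
    = mono (fun x => (a x)%:R * k) (dec a l) psi.
Proof.
elim: l => [|r l IH].
  by exists 0 => psi; rewrite /= /mono; apply: funext => x; rewrite !mulr0.
move=> /andP[rl ul] ia.
have [q|k kP] := IH ul; first by move=> ql; apply: ia; rewrite inE ql orbT.
have ra : indep r a by apply: ia; rewrite inE eqxx.
pose al : R := pi / 2 ^+ size l.
(* The term $-al/2$ is the contribution of [gr] at [x r] equal to 0. *)
exists (k - al / 2) => psi.
pose CV := cval r 0 al l.
pose gr x := (a x)%:R * (- (al / 2) * (-1) ^+ (x r)).
have -> : qf (r :: l) = [:: Single r (rot (- (pi / 4)))] ++ CV ++ qf l by [].
rewrite !cinv_cat !circ_cat !circ1.
have -> phi : mono (fun x => (a x)%:R * gval R (r :: l) x) id phi =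
   mono gr id (mono (fun x => (a x)%:R * gval R l x) id phi).
  rewrite mono_comp; apply: (congr1 (fun F : _ -> state R n => F phi)).
  apply: eq_mono => // x; congr expi.
  rewrite -[gval _ (r :: l) x]/(- (pi / 2 ^+ (size l).+1) * (-1) ^+ (x r) + gval R l x).
  rewrite /gr /al exprS invfM; ring.
(* The rotation of [r] passes through the transform of the lower qubits, which never targets [r]. *)
rewrite circ_phaseC; last first.
  move=> q; rewrite cinv_target mem_rev => /qf_target ql x b.
  rewrite /gr ia ?inE ?ql ?orbT // setbit_neq //.
  by apply: contraNneq rl => ->.
rewrite kP (cinv_phase (cval_valid _ _ rl) (cval_mono _ _ rl)) cval_mono //.
rewrite /ginv adjmx_rot opprK !mono_comp.
have fl : fixes r (dec a l) by apply: dec_fixes.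
have il x b : a (setbit x r b) = a x by apply: ra.
have al_pi : al * 2 ^+ size l = pi by rewrite /al divfK // expf_neq0 // pnatr_eq0.
rewrite (@rot_conj_op _ _ r _ _ (fun x => a x && all (dec a l x) l)).
- apply: (congr1 (fun F : _ -> state R n => F psi)); apply: eq_mono => x //=; congr expi.
  by rewrite /gr il fl !setbit_eq expr0; ring.
- by move=> x b; apply: fl.
move=> x /=; rewrite /gr !il !fl !setbit_eq !regval_setbit // expr0 expr1.
(* The controlled phases leave $al \cdot x_r (v' - v)$ with $v' - v = z 2^{|l|} - a$. Its $a$ term
   cancels against [gr], and what remains is $z\pi x_r$, a flip of [r] after rotation. *)
have vd := regval_dec a x ul; rewrite -al_pi.
set v := regval l x in vd *; set v' := regval l _ in vd *; set z := (_ && _)%:R in vd *.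
have -> : v' = v + z * 2 ^+ size l - (a x)%:R by rewrite -vd addrK.
by field.
Qed.

Definition adder c1 (l1 : seq ('I_n * 'I_n)) c2 (l2 : seq ('I_n * 'I_n)) reg : seq (gate R n) :=
  qf reg ++ mrot R c1 l1 c2 l2 reg ++ cinv (qf reg).

(** The phase [f] may stay unspecified, since the adder is used only inside a conjugation, where
    [conj_phase] cancels it. *)
Lemma adder_mono c1 (l1 : seq ('I_n * 'I_n)) c2 (l2 : seq ('I_n * 'I_n)) reg :
  l1 != [::] -> l2 != [::] ->
  uniq (reg ++ c1 :: unzip1 l1 ++ unzip2 l1) ->
  uniq (reg ++ c2 :: unzip1 l2 ++ unzip2 l2) ->
  exists f, circ_apply (adder c1 l1 c2 l2 reg) =
    mono f (dec (fun x => all x (c1 :: unzip1 l1) && all x (c2 :: unzip1 l2)) reg).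
Proof.
move=> n1 n2 U1 U2; set a := fun x => _ && _.
have nin c (l : seq ('I_n * 'I_n)) : uniq (reg ++ c :: unzip1 l ++ unzip2 l) ->
    {in reg, forall q, q \notin c :: unzip1 l}.
  rewrite cat_uniq => /and3P[_ /hasPn dj _] q qr; apply/negP => qc.
  have := dj q; rewrite -cat_cons mem_cat qc => /(_ isT) /=.
  by rewrite qr.
have [||k kP] := @qf_conj a reg.
- by move: U1; rewrite cat_uniq => /and3P[].
- by move=> q qr x b; rewrite /a !all_setbit //; apply: nin.
exists (fun x => (a x)%:R * k); apply: funext => psi.
by rewrite !circ_cat mrot_mono // kP.
Qed.

Lemma adder_valid c1 (l1 : seq ('I_n * 'I_n)) c2 (l2 : seq ('I_n * 'I_n)) reg :
  l1 != [::] -> l2 != [::] ->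
  uniq (reg ++ c1 :: unzip1 l1 ++ unzip2 l1) ->
  uniq (reg ++ c2 :: unzip1 l2 ++ unzip2 l2) ->
  cvalid (adder c1 l1 c2 l2 reg).
Proof.
move=> n1 n2 U1 U2.
have vq : cvalid (qf reg) by apply: qf_valid; move: U1; rewrite cat_uniq => /and3P[].
apply/cvalid_cat; split=> //; apply/cvalid_cat; split; last exact: cinv_valid.
exact: mrot_valid.
Qed.

(** The factor [0 < size reg] covers the empty register, on which [mrot] is empty. *)
Lemma ncnot_adder c1 (l1 : seq ('I_n * 'I_n)) c2 (l2 : seq ('I_n * 'I_n)) reg :
  l1 != [::] -> l2 != [::] ->
  (ncnot (adder c1 l1 c2 l2 reg) + 2 * size reg <=
   2 * size reg ^ 2 + (0 < size reg) *
     (16 * ((size l1).+1 + (size l2).+1) + 8 * size reg - 32))%N.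
Proof.
move=> n1 n2; rewrite !ncnot_cat ncnot_cinv; have := ncnot_qf reg.
case: reg => [|s rs]; first by rewrite /ncnot /=.
have := ncnot_mrot R c1 c2 s rs n1 n2; rewrite [size (_ :: _)]/= mul1n; lia.
Qed.

End Adder.

(** * The complete circuit, the power it applies, and its cost *)

Section Assembly.
Variables (R : realType) (n : nat).
Local Notation C := R[i].
Variables (t c1 c2 : 'I_n) (l1 l2 : seq ('I_n * 'I_n)) (reg : seq 'I_n).
Variables (W : 'M[C]_2) (b0 b1 : R).
Hypothesis l1n : l1 != [::].
Hypothesis l2n : l2 != [::].
Hypothesis U1 : uniq (reg ++ c1 :: unzip1 l1 ++ unzip2 l1).
Hypothesis U2 : uniq (reg ++ c2 :: unzip1 l2 ++ unzip2 l2).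
Hypothesis tN : t \notin reg ++ (c1 :: unzip1 l1) ++ c2 :: unzip1 l2.
Hypothesis uW : qunitary W.
Implicit Types (x y : bits n).

Let a x := all x (c1 :: unzip1 l1) && all x (c2 :: unzip1 l2).

(** Between the changes of basis by [W], powers of the gate are phases on [t]: [cval] uses [t] as
    control to select the angle of the eigenvalue. The final diagonal is the unconditional root. *)
Definition cu_circuit : seq (gate R n) :=
  let A := adder R c1 l1 c2 l2 reg in
  [:: Single t (adjmx W)]
    ++ (A ++ cval t (- b0) (- b1) reg ++ cinv A)
    ++ cval t b0 b1 reg
    ++ [:: Single t (diag2 (expi b0) (expi b1)); Single t W].

(** The power of the root that reaches the target: $2^m$ when all controls are 1, 0 when only the
    register fails, and 1 when [a] fails. *)
Definition cu_exponent x : R := 1 - (a x)%:R + (a x && all x reg)%:R * 2 ^+ size reg.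

Let tNreg : t \notin reg.
Proof. by apply: contraNN tN; rewrite mem_cat => ->. Qed.

Let regNa : {in reg, forall q, (q \notin c1 :: unzip1 l1) && (q \notin c2 :: unzip1 l2)}.
Proof.
have nin c (l : seq ('I_n * 'I_n)) : uniq (reg ++ c :: unzip1 l ++ unzip2 l) ->
    {in reg, forall q, q \notin c :: unzip1 l}.
  rewrite cat_uniq => /and3P[_ /hasPn dj _] q qr; apply/negP => qc.
  have := dj q; rewrite -cat_cons mem_cat qc => /(_ isT) /=.
  by rewrite qr.
by move=> q qr; rewrite !nin.
Qed.

Lemma cu_valid : cvalid cu_circuit.
Proof.
have vA := adder_valid R l1n l2n U1 U2.
have vC d0 d1 := cval_valid (d0 : R) d1 tNreg.
apply/cvalid_cat; split; first by split=> //; apply: adjmx_unitary.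
apply/cvalid_cat; split.
  apply/cvalid_cat; split=> //; apply/cvalid_cat; split=> //; exact: cinv_valid.
by apply/cvalid_cat; split=> //; split=> //; apply: diag2_unitary.
Qed.

Let a_indep q : q \notin c1 :: unzip1 l1 -> q \notin c2 :: unzip1 l2 -> indep q a.
Proof. by move=> q1 q2 x b; rewrite /a !all_setbit. Qed.

Let a_indep_t : indep t a.
Proof. by apply: a_indep; apply: contraNN tN => tc; rewrite !mem_cat tc ?orbT. Qed.

Lemma cu_exponent_indep : indep t cu_exponent.
Proof. by move=> x b; rewrite /cu_exponent a_indep_t all_setbit. Qed.

Lemma cu_blk : circ_apply cu_circuit =
  blk t (fun x => W *m diag2 (expi (b0 * cu_exponent x)) (expi (b1 * cu_exponent x)) *m adjmx W) id.
Proof.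
have [f Af] := adder_mono R l1n l2n U1 U2; rewrite -/a in Af.
have aD x : a (dec a reg x) = a x.
  by rewrite /a; congr (_ && _); apply: eq_in_all => q ql; apply: dec_notin;
    apply: contraTN ql => /regNa /andP[].
have ur : uniq reg by move: U1; rewrite cat_uniq => /and3P[].
(* The new phase must be a function of the decremented string; [regval_dec] recovers the old
   register value from it. *)
have Df := conj_phase (w' := fun y => (if y t then - b1 else - b0) *
  (regval R reg y + (a y)%:R - (a y && all y reg)%:R * 2 ^+ size reg))
  (adder_valid R l1n l2n U1 U2) Af (cval_mono (- b0) (- b1) tNreg).
apply: funext => psi.
rewrite /cu_circuit circ_cat circ_cat Df; last first.
  by move=> x; rewrite aD dec_notin // regval_dec // addrK.
rewrite circ_cat cval_mono // circ1 -[circ_apply [:: _; _] _]/(gate_apply (Single t W) (gate_apply _ _)).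
rewrite diag_mono !mono_comp !single_blk (@mono_blk _ _ t) // !blk_comp //; last first.
  by move=> x b; rewrite !setbit2.
apply: (congr1 (fun F : _ -> state R n => F psi)); apply: eq_blk => // x /=.
congr (_ *m diag2 _ _ *m _); congr expi; rewrite !setbit_eq ?a_indep_t !all_setbit // !regval_setbit //
  /cu_exponent; ring.
Qed.

(** Two adders and two [cval] of $2m$ CNOTs each, $m$ being the register size. *)
Lemma ncnot_cu : (0 < size reg)%N ->
  (ncnot cu_circuit + 64 <= 4 * size reg ^ 2 + 16 * size reg
                            + 32 * ((size l1).+1 + (size l2).+1))%N.
Proof.
move=> m0; have := ncnot_adder R c1 c2 reg l1n l2n; rewrite m0 mul1n /cu_circuit.
move: (adder R c1 l1 c2 l2 reg) => A; rewrite !ncnot_cat !ncnot_cval ncnot_cinv.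
by rewrite [ncnot [:: _]]/ncnot [ncnot [:: _; _]]/ncnot [count _ _]/= [count _ _]/=; lia.
Qed.

Lemma ncnot_cu0 : size reg = 0%N -> ncnot cu_circuit = 0%N.
Proof.
move=> m0; have := ncnot_adder R c1 c2 reg l1n l2n; rewrite m0 /cu_circuit.
move: (adder R c1 l1 c2 l2 reg) => A; rewrite !ncnot_cat !ncnot_cval ncnot_cinv m0.
by rewrite [ncnot [:: _]]/ncnot [ncnot [:: _; _]]/ncnot [count _ _]/= [count _ _]/=; lia.
Qed.

End Assembly.

(** * Splitting basis states into controls and target, and the final choice of registers *)

Section ControlledGate.
Variables (R : realType) (nc : nat).
Local Notation C := R[i].
Implicit Types (x y : bits nc.+1).

Definition ctrls : seq 'I_nc.+1 := [seq widen_ord (leqnSn nc) i | i <- enum 'I_nc].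

Lemma ctrls_uniq : uniq (ord_max :: ctrls).
Proof.
rewrite /= map_inj_uniq ?enum_uniq ?andbT; last first.
  by move=> i j /(congr1 val) /= /val_inj.
by apply/mapP => -[i _ /(congr1 val) /= e]; have := ltn_ord i; rewrite -e ltnn.
Qed.

Lemma size_ctrls : size ctrls = nc.
Proof. by rewrite size_map size_enum_ord. Qed.

Lemma all_ctrls x : all x ctrls = (ctrl x == [ffun=> true]).
Proof.
apply/allP/eqP => [h | h _ /mapP[i _ ->]].
  by apply/ffunP => i; rewrite !ffunE h // map_f // mem_enum.
by have := congr1 (fun f : bits nc => f i) h; rewrite !ffunE.
Qed.

Lemma ord_max_widen (i : 'I_nc.+1) : i = ord_max \/ exists j : 'I_nc, i = widen_ord (leqnSn nc) j.
Proof.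
have [lti|gei] := ltnP i nc; [right | left]; last first.
  by apply/val_inj/eqP; rewrite eqn_leq gei -ltnS ltn_ord.
by exists (Ordinal lti); apply: val_inj.
Qed.

Lemma bits_eq x y : (x == y) = (ctrl x == ctrl y) && (tgt x == tgt y).
Proof.
apply/eqP/andP => [-> // | [/eqP cxy /eqP txy]].
apply/ffunP => i; have [->//|[j ->]] := ord_max_widen i.
by have := congr1 (fun f : bits nc => f j) cxy; rewrite !ffunE.
Qed.

Lemma ctrl_setbit x b : ctrl (setbit x ord_max b) = ctrl x.
Proof.
apply/ffunP => j; rewrite !ffunE; case: eqP => // /(congr1 val) /= e.
by have := ltn_ord j; rewrite e ltnn.
Qed.

Lemma blk_kbasis (G : bits nc -> 'M[C]_2) x y :
  blk ord_max (fun x => G (ctrl x)) id (kbasis R x) y =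
  if ctrl y == ctrl x then G (ctrl x) (bidx (tgt y)) (bidx (tgt x)) else 0.
Proof.
rewrite /blk /kbasis !bits_eq !ctrl_setbit /tgt !setbit_eq.
case: eqP => [->|_] /=; last by rewrite !mulr0 addr0.
by case: (x ord_max); rewrite /= ?mulr1 ?mulr0 ?addr0 ?add0r.
Qed.

(** The target bit is set to false, an arbitrary choice: [ext] is applied to functions independent
    of the target. *)
Definition ext (xc : bits nc) : bits nc.+1 := [ffun i => oapp xc false (unlift ord_max i)].

Lemma ext_widen xc j : ext xc (widen_ord (leqnSn nc) j) = xc j.
Proof.
have -> : widen_ord (leqnSn nc) j = lift ord_max j by apply: val_inj; exact/esym/lift_max.
by rewrite ffunE liftK.
Qed.

Lemma ctrl_ext xc : ctrl (ext xc) = xc.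
Proof. by apply/ffunP => j; rewrite ffunE ext_widen. Qed.

Lemma ext_ctrl x : ext (ctrl x) = setbit x ord_max false.
Proof.
apply/eqP; rewrite bits_eq ctrl_ext ctrl_setbit eqxx /tgt setbit_eq.
by rewrite ffunE unlift_none.
Qed.

Lemma valid_all_valid (c : seq (gate R nc.+1)) : cvalid c -> all_valid c.
Proof.
move=> vc [i /= lti]; elim: c i lti vc => // g c IH [|i] /= lti [vg vc] //.
exact: IH.
Qed.

End ControlledGate.

Theorem theorem3 (R : realType) (U : 'M[R[i]]_2) (eps : R) (nb nc : nat) :
  qunitary U -> 0 < eps -> (0 < nb)%N ->
  (exists V : 'M[R[i]]_2,
      principal_root U (2 ^ (nb - 1)) V /\ maxnorm_le (V - 1%:M) eps) ->
  (0 < nc)%N -> (nb + 8 <= nc.+1)%N ->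
  exists c : seq (gate R nc.+1),
    [/\ all_valid c, approx_CU c U eps &
        (count (@is_cnot R nc.+1) c + 112 <= 4 * (nb - 1) ^ 2 + 32 * nc.+1)%N].
Proof.
move=> _ eps0 nb0 [V [[W [t0 [t1 [uW _ _ UE VE]]]] Veps]] _ n8.
set m := (nb - 1)%N in VE *.
have m8 : (m + 8 <= nc)%N by rewrite /m; lia.
pose reg := take m (ctrls nc); pose rest := drop m (ctrls nc).
pose h := (size rest)./2; pose A1 := take h rest; pose A2 := drop h rest.
have szr : size reg = m by rewrite size_take size_ctrls; case: ltngtP; lia.
have szrest : size rest = (nc - m)%N by rewrite size_drop size_ctrls.
have szA1 : size A1 = h by rewrite size_take; case: ltnP => //; rewrite /h; lia.
have szA2 : size A2 = (size rest - h)%N by rewrite size_drop.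
have ctrlsE : reg ++ A1 ++ A2 = ctrls nc by rewrite !cat_take_drop.
have uctrls : uniq (ord_max :: reg ++ A1 ++ A2) by rewrite ctrlsE ctrls_uniq.
case E1 : A1 szA1 uctrls ctrlsE => [|c1 B1]; first by rewrite /h /=; lia.
case E2 : A2 szA2 => [|c2 B2]; first by rewrite /h /=; lia.
move=> /= szA2 szA1 uctrls ctrlsE.
(* Each half of the remaining controls lends qubits to the chain of the other. Since [c1] and [c2]
   stay outside the chains and the halves differ in size by at most one, each half is long enough to
   lend. *)
pose l1 := zip B1 (take (size B1) (c2 :: B2)).
pose l2 := zip B2 (take (size B2) (c1 :: B1)).
have sz1 : size (take (size B1) (c2 :: B2)) = size B1.
  by rewrite size_takel //= ; move: szA1 szA2; rewrite /h; lia.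
have sz2 : size (take (size B2) (c1 :: B1)) = size B2.
  by rewrite size_takel //= ; move: szA1 szA2; rewrite /h; lia.
have [z1 z2] : unzip1 l1 = B1 /\ unzip1 l2 = B2 by rewrite !unzip1_zip ?sz1 ?sz2.
have [y1 y2] : unzip2 l1 = take (size B1) (c2 :: B2) /\ unzip2 l2 = take (size B2) (c1 :: B1).
  by rewrite !unzip2_zip ?sz1 ?sz2.
have [s1 s2] : size l1 = size B1 /\ size l2 = size B2 by rewrite !size_zip sz1 sz2 !minnn.
have l1n : l1 != [::] by rewrite -size_eq0 s1; move: szA1; rewrite /h; lia.
have l2n : l2 != [::] by rewrite -size_eq0 s2; move: szA2; rewrite /h; lia.
have [tN uA] := andP uctrls.
have U1 : uniq (reg ++ c1 :: unzip1 l1 ++ unzip2 l1).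
  rewrite z1 y1; apply: subseq_uniq uA; apply: cat_subseq => //.
  by rewrite -!cat_cons; apply: cat_subseq => //; apply: take_subseq.
have U2 : uniq (reg ++ c2 :: unzip1 l2 ++ unzip2 l2).
  rewrite z2 y2; apply: (@subseq_uniq _ _ (reg ++ (c2 :: B2) ++ (c1 :: B1))).
    by apply: cat_subseq => //; rewrite -!cat_cons; apply: cat_subseq => //; apply: take_subseq.
  rewrite (perm_uniq (s2 := reg ++ (c1 :: B1) ++ (c2 :: B2))) //.
  by rewrite perm_cat2l perm_catC.
have tN' : ord_max \notin reg ++ (c1 :: unzip1 l1) ++ c2 :: unzip1 l2 by rewrite z1 z2.
(* The eigenangles of the root [V]. *)
pose b0 := t0 / 2 ^+ m; pose b1 := t1 / 2 ^+ m.
exists (cu_circuit ord_max c1 c2 l1 l2 reg W b0 b1); split.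
- exact/valid_all_valid/cu_valid.
- pose e := cu_exponent R c1 c2 l1 l2 reg.
  pose G x := W *m diag2 (expi (b0 * e x)) (expi (b1 * e x)) *m adjmx W.
  have GE : G =1 fun x => G (ext (ctrl x)).
    by move=> x; rewrite /G ext_ctrl /e cu_exponent_indep.
  exists (fun xc => G (ext xc)); split=> [x y | xc].
    by rewrite cu_blk // (eq_blk _ GE (frefl _)) (blk_kbasis (fun xc => G (ext xc))).
  rewrite -{1}(ctrl_ext xc) -all_ctrls -ctrlsE; move: (ext xc) => x.
  have eps0' : 0 <= eps%:C :> R[i] by rewrite lecR ltW.
  have p2 : 2 ^+ m != 0 :> R by rewrite expf_neq0 // pnatr_eq0.
  rewrite all_cat -cat_cons all_cat /G /e /cu_exponent z1 z2 szr.
  (* The exponents are $2^m$, 0, 1, 1: exactly [U], exactly the identity, and twice [V], which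
     [Veps] places within [eps] of the identity. *)
  case: (all x (c1 :: B1) && all x (c2 :: B2)); case: (all x reg);
    rewrite /= ?subr0 ?subrr ?mul1r ?mul0r ?add0r ?addr0 ?mulr1 ?mulr0.
  + by rewrite /b0 /b1 !divfK // -UE subrr => i j; rewrite mxE normr0.
  + have -> : diag2 (expi 0) (expi 0) = 1%:M :> 'M[R[i]]_2.
      by apply: bidx_mxP => i j; rewrite diag2E unit2E expi0; case: i; case: j.
    by rewrite mulmx1 uW subrr => i j; rewrite mxE normr0.
  + by rewrite /b0 /b1 -natrX -VE.
  + by rewrite /b0 /b1 -natrX -VE.
(* With $n$ = [nc.+1], the general count is at most $4m^2 + 16m + 32(n-1-m) - 64 = 4m^2 - 16m + 32n
   - 96$, which meets the bound once $m \ge 1$. For $m = 0$ only single-qubit gates remain. *)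
- case: (posnP m) => [m0|mp].
    by rewrite -/(ncnot _) ncnot_cu0 ?szr //; lia.
  have : (ncnot (cu_circuit ord_max c1 c2 l1 l2 reg W b0 b1) + 64 <=
    4 * size reg ^ 2 + 16 * size reg + 32 * ((size l1).+1 + (size l2).+1))%N.
    by apply: ncnot_cu; rewrite ?szr.
  rewrite szr s1 s2 /ncnot; move: szA1 szA2 szrest; rewrite /h; lia.
Qed.
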